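(* For every $n\ge 3$, $\gamma_{\rm MB}(C_n)=\gamma_{\rm MB}'(C_n)=\left\lfloor \frac{n}{2}\right\rfloor$, where $C_n$ is the cycle on $n$ vertices.
   Context: The Maker-Breaker domination game on a graph: Dominator and Staller alternately select a vertex not selected before; Dominator wins if at some point his selected vertices form a dominating set, Staller wins otherwise. In the D-game Dominator moves first, in the S-game Staller moves first. $\gamma_{\rm MB}(G)$ (resp. $\gamma_{\rm MB}'(G)$) is the minimum $k$ such that Dominator has a strategy in the D-game (resp. S-game) guaranteeing that his selected vertices dominate $G$ after at most $k$ of his moves, whatever Staller does, and is $\infty$ if he has no winning strategy. *)

(* Defs.v *)
From mathcomp Require Import all_boot.
From mathcomp Require Import boolp.

Set Implicit Arguments.
Unset Strict Implicit.
Unset Printing Implicit Defensive.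

(* A simple graph is a symmetric irreflexive relation on a finite type. *)

Definition dominating (T : finType) (e : rel T) (A : {set T}) : bool :=
  [forall v, exists u in A, (u == v) || e u v].

(* A play is recorded as the duplicate-free sequence of the vertices selected
   by both players, in chronological order.  The boolean dfirst is true in the
   D-game and false in the S-game. *)

Definition Dturn (dfirst : bool) (i : nat) : bool := odd i (+) dfirst.

Definition Dmoves (T : finType) (dfirst : bool) (p : seq T) : seq T :=
  mask (mkseq (Dturn dfirst) (size p)) p.

(* A strategy maps the history of the play to the next vertex; its values on
   full or illegal histories are irrelevant.  As usual, the graph is assumed to
   have at least one vertex. *)
Definition legal_strategy (T : finType) (sigma : seq T -> T) : Prop :=
  forall h : seq T, uniq h -> size h < #|T| -> sigma h \notin h.

Definition follows (T : finType) (dfirst : bool) (sigma : seq T -> T)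
    (p : seq T) : Prop :=
  forall (h t : seq T) (v : T),
    p = h ++ v :: t -> Dturn dfirst (size h) -> v = sigma h.

(* Plays are continued until all vertices are selected: this is harmless, as
   only the first k moves of Dominator are inspected and supersets of
   dominating sets are dominating. *)
Definition dominates_within (T : finType) (e : rel T) (dfirst : bool) (k : nat)
    (sigma : seq T -> T) : Prop :=
  forall p : seq T, uniq p -> size p = #|T| -> follows dfirst sigma p ->
    dominating e [set v in take k (Dmoves dfirst p)].

Definition Dominator_can (T : finType) (e : rel T) (dfirst : bool) (k : nat)
    : Prop :=
  exists sigma : seq T -> T,
    legal_strategy sigma /\ dominates_within e dfirst k sigma.

(* None stands for infinity. *)
Definition MB_number (T : finType) (e : rel T) (dfirst : bool) : option nat :=
  match pselect (exists k, `[< Dominator_can e dfirst k >]) with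
  | left ex_k => Some (ex_minn ex_k)
  | right _ => None
  end.

Definition gammaMB (T : finType) (e : rel T) : option nat := MB_number e true.
Definition gammaMB' (T : finType) (e : rel T) : option nat := MB_number e false.

(* ordS is the successor modulo n; the relation is a simple graph for n > 1 and
   the cycle on n vertices for n > 2. *)
Definition cycle_graph (n : nat) : rel 'I_n :=
  fun i j => (j == ordS i) || (i == ordS j).

Lemma cycle_graph_sym n : symmetric (@cycle_graph n).
Proof. by move=> i j; rewrite /cycle_graph orbC. Qed.

Lemma cycle_graph_irr n : 1 < n -> irreflexive (@cycle_graph n).
Proof.
move=> n_gt1 i; rewrite /cycle_graph orbb; apply/negbTE/eqP => /(congr1 val)/=.
have := ltn_ord i; rewrite leq_eqVlt => /predU1P[i1n|i1n].
  by rewrite i1n modnn => i0; rewrite -i1n i0 in n_gt1.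
by rewrite modn_small // => /n_Sn.
Qed.

(* Main.v *)
Require Import Defs.
From mathcomp Require Import all_boot.
From mathcomp Require Import boolp zify.

(* Upper bound: let K = n %/ 2 and choose K disjoint pairs of consecutive
   vertices starting with {c, c+1}, the only vertex possibly left out being c+2
   (for n odd), where c is chosen so that the first move of Dominator is c+1.
   Dominator then always plays in a pair he has not hit yet, giving priority to
   the one that Staller has just entered, so his first K moves hit all pairs.

   Lower bound: let W be a set of pairwise nonadjacent undominated vertices.
   If a free vertex v has both neighbours in W, Staller plays it, and otherwise
   he plays anything.  The reply of Dominator dominates at most one vertex of W,
   unless he plays elsewhere between two vertices of W; but then Staller makes
   a double threat around v and isolates a vertex.  Hence Dominator needs at
   least #|W| further moves, and the even vertices provide a W of size n %/ 2. *)

Set Implicit Arguments.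
Unset Strict Implicit.
Unset Printing Implicit Defensive.

(** * Plays, delaying by Staller, and strategies of Dominator from invariants *)

Section Plays.
Variables (T : finType) (dfirst : bool).
Implicit Types (h p : seq T) (sigma : seq T -> T).

Lemma Dmoves_rcons h v :
  Dmoves dfirst (rcons h v) =
  if Dturn dfirst (size h) then rcons (Dmoves dfirst h) v else Dmoves dfirst h.
Proof.
rewrite /Dmoves size_rcons /mkseq -addn1 iotaD map_cat /= add0n cats1.
rewrite mask_rcons ?size_map ?size_iota //.
by case: (Dturn _ _); rewrite ?cats1 ?cats0.
Qed.

Lemma Dmoves_cat h t : exists t', Dmoves dfirst (h ++ t) = Dmoves dfirst h ++ t'.
Proof.
elim/last_ind: t => [|t v [t' IH]]; first by exists [::]; rewrite !cats0.
rewrite -rcons_cat Dmoves_rcons IH; case: (Dturn _ _); last by exists t'.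
by exists (rcons t' v); rewrite rcons_cat.
Qed.

Lemma follows_nil sigma : follows dfirst sigma [::].
Proof. by case. Qed.

Lemma follows_rcons sigma h v :
  follows dfirst sigma (rcons h v) <->
  follows dfirst sigma h /\ (Dturn dfirst (size h) -> v = sigma h).
Proof.
split=> [fol|[fol vE] h1 t u].
  split=> [h1 t u hE|]; last by apply: (fol h [::] v); rewrite cats1.
  by apply: (fol h1 (rcons t v) u); rewrite hE rcons_cat.
elim/last_ind: t => [|t w _]; first by rewrite cats1 => /rcons_inj[<- <-].
by rewrite -rcons_cons -rcons_cat => /rcons_inj[hE _]; apply: fol hE.
Qed.

Lemma exists_notin h : size h < #|T| -> exists v, v \notin h.
Proof.
move=> lt_h; apply/existsP; apply: contraTT lt_h => /existsPn noV.
rewrite -leqNgt (leq_trans _ (card_size h)) //; apply: subset_leq_card.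
by apply/subsetP => v _; have := noV v; rewrite negbK.
Qed.

Lemma uniq_size_leq h : uniq h -> size h <= #|T|.
Proof. by move/card_uniqP <-; apply: max_card. Qed.

(** Needed because [dominates_within] only speaks of full plays. One appends [sigma h] when
    Dominator is to move and any free vertex otherwise. *)
Lemma play_extension sigma h :
  legal_strategy sigma -> uniq h -> follows dfirst sigma h ->
  exists t, [/\ uniq (h ++ t), size (h ++ t) = #|T|
              & follows dfirst sigma (h ++ t)].
Proof.
move=> legal; move def_m : (#|T| - size h) => m.
elim: m h def_m => [|m IH] h def_m Uh fol.
  exists [::]; rewrite cats0; split=> //; apply/eqP.
  by rewrite eqn_leq uniq_size_leq //= -subn_eq0 def_m.
have lt_h : size h < #|T| by rewrite -subn_gt0 def_m.
have [v vh vE] : exists2 v, v \notin h & Dturn dfirst (size h) -> v = sigma h.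
  case: (Dturn _ _); first by exists (sigma h) => //; apply: legal.
  by have [v vh] := exists_notin lt_h; exists v.
have [|||t []] := IH (rcons h v).
- by rewrite size_rcons subnS def_m.
- by rewrite rcons_uniq vh.
- by apply/follows_rcons.
by rewrite cat_rcons; exists (v :: t).
Qed.

Variable (e : rel T).

(* Staller, to move, can keep Dominator from having a dominating set after [k]
   further moves of his, [D] being his present set and [S] a set of vertices
   he may not use; choosing [s] in [D] or [S] amounts to a pass. *)
Fixpoint Staller_delays (k : nat) (D S : {set T}) : Prop :=
  if k is k'.+1 then
    exists s, forall d, d \notin s |: S -> Staller_delays k' (d |: D) (s |: S)
  else ~~ dominating e D.

(** As [S] consists of played vertices, the legal replies of [sigma] are among those that
    [Staller_delays] allows for. The size bound leaves room for [k] full rounds. *)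
Lemma delay_play sigma k h (S : {set T}) :
  legal_strategy sigma -> uniq h -> follows dfirst sigma h ->
  ~~ Dturn dfirst (size h) -> size h + k.*2 <= #|T| -> {subset S <= h} ->
  Staller_delays k [set v in Dmoves dfirst h] S ->
  exists p, [/\ uniq p, size p = #|T|, follows dfirst sigma p
    & ~~ dominating e [set v in take (size (Dmoves dfirst h) + k) (Dmoves dfirst p)]].
Proof.
move=> legal; elim: k h S => [|k IH] h S Uh fol Sturn size_h sSh /=.
  move=> ndom; have [t [Up szp folp]] := play_extension legal Uh fol.
  exists (h ++ t); split=> //; have [t' ->] := Dmoves_cat h t.
  by rewrite addn0 take_size_cat.
case=> s Ds.
(* A pass, that is an [s] already played, is realised by any free vertex [s']. *)
have [s' s'h sE] : exists2 s', s' \notin h & s \in rcons h s'.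
  have [sh|sh] := boolP (s \in h); last by exists s; rewrite ?mem_rcons ?mem_head.
  have [|s' s'h] := @exists_notin h; first by lia.
  by exists s' => //; rewrite mem_rcons inE sh orbT.
set h1 := rcons h s'; set d := sigma h1.
have Uh1 : uniq h1 by rewrite rcons_uniq s'h.
have dh1 : d \notin h1 by apply: legal => //; rewrite size_rcons; lia.
have D1 : Dmoves dfirst h1 = Dmoves dfirst h by rewrite Dmoves_rcons (negbTE Sturn).
have Dt1 : Dturn dfirst (size h1) by rewrite size_rcons /Dturn /= addNb.
have D2 : Dmoves dfirst (rcons h1 d) = rcons (Dmoves dfirst h) d.
  by rewrite Dmoves_rcons Dt1 D1.
have sSh1 : {subset s |: S <= h1}.
  by move=> x /setU1P[->|/sSh xh] //; rewrite mem_rcons inE xh orbT.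
have [||||||p] := IH (rcons h1 d) (s |: S).
- by rewrite rcons_uniq dh1.
- apply/follows_rcons; split=> //; apply/follows_rcons; split=> //.
  by rewrite (negbTE Sturn).
- by move: Dt1; rewrite size_rcons /Dturn /= addNb => ->.
- by rewrite !size_rcons; lia.
- by move=> x /sSh1 xh; rewrite mem_rcons inE xh orbT.
- have -> : [set v in Dmoves dfirst (rcons h1 d)] = d |: [set v in Dmoves dfirst h].
    by apply/setP=> x; rewrite D2 !inE mem_rcons inE.
  by apply: Ds; apply: contra dh1; apply: sSh1.
by rewrite D2 size_rcons addSnnS => ?; exists p.
Qed.

(** [Inv] concerns positions with Staller to move, and Dominator restores it in each round. The
    third hypothesis covers the end, where at most one free vertex remains and no full round is
    possible. *)
Lemma strategy_of_invariant (k : nat) (Inv : seq T -> Prop) :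
    (if dfirst then exists d, Inv [:: d] else Inv [::]) ->
    (forall h s, uniq (rcons h s) -> size h + 2 <= #|T| ->
       ~~ Dturn dfirst (size h) -> Inv h ->
       exists2 d, d \notin rcons h s & Inv (rcons (rcons h s) d)) ->
    (forall h, uniq h -> #|T| <= (size h).+1 -> ~~ Dturn dfirst (size h) ->
       Inv h -> dominating e [set v in take k (Dmoves dfirst h)]) ->
    0 < #|T| ->
  Dominator_can e dfirst k.
Proof.
move=> Inv0 InvS InvE T0; have [v0 _] := @exists_notin [::] T0.
pose good h d := (d \notin h) && `[< Inv (rcons h d) >].
(* The fallback to any free vertex makes [sigma] legal; [v0] is a mere default. *)
pose sigma h := if [pick d | good h d] is Some d then d
                else odflt v0 [pick d | d \notin h].
have sigmaP h : (exists d, good h d) -> good h (sigma h).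
  by case=> d gd; rewrite /sigma; case: pickP => // /(_ d); rewrite gd.
exists sigma; split=> [h Uh lt_h|p Up szp fol].
  rewrite /sigma; case: pickP => [d /andP[] //|_]; case: pickP => //= noV.
  by have [v vh] := exists_notin lt_h; have := noV v; rewrite vh.
have reach h : uniq h -> follows dfirst sigma h ->
    if Dturn dfirst (size h) then
      h = [::] \/ exists h' s, h = rcons h' s /\ Inv h'
    else Inv h.
  elim/last_ind: h => [|h v IH].
    by rewrite /Dturn /=; move: Inv0; case: (dfirst) => // _ _ _; left.
  rewrite rcons_uniq => /andP[vh Uh] /follows_rcons[folh vE].
  have {IH} := IH Uh folh; rewrite size_rcons /Dturn /= -/(Dturn _ _) addNb.
  rewrite -/(Dturn dfirst (size h)).
  case: ifPn => [Dt|St IH] /=; last by right; exists h, v.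
  move=> IH; rewrite (vE Dt).
  suff /sigmaP/andP[_ /asboolP] : exists d, good h d by [].
  case: IH => [h0|[h' [s [hE Inv']]]].
    have : dfirst by move: Dt; rewrite h0.
    move=> df; move: Inv0; rewrite df => -[d Id]; exists d.
    by rewrite /good h0 /=; apply/asboolP.
  have [|||d dh Id] := InvS h' s _ _ _ Inv'.
  - by rewrite -hE.
  - have := @uniq_size_leq (rcons h v).
    by rewrite rcons_uniq vh Uh hE !size_rcons addn2; apply.
  - by move: Dt; rewrite hE size_rcons /Dturn /= addNb.
  by exists d; rewrite /good hE dh; apply/asboolP.
(* If Staller made the last move, drop it: the moves of Dominator stay the same. *)
have := reach p Up fol; case: ifPn => [Dt|St] Ip; last first.
  by apply: InvE => //; rewrite szp.
case: Ip => [p0|[h' [s [pE Ih]]]]; first by rewrite p0 /= in szp; rewrite -szp in T0.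
have St : ~~ Dturn dfirst (size h').
  by move: Dt; rewrite pE size_rcons /Dturn /= addNb.
rewrite pE Dmoves_rcons (negbTE St); apply: InvE => //.
  by move: Up; rewrite pE rcons_uniq => /andP[].
by rewrite -szp pE size_rcons.
Qed.

End Plays.

Lemma MB_numberP (T : finType) (e : rel T) dfirst k :
  Dominator_can e dfirst k ->
  (forall j, j < k -> ~ Dominator_can e dfirst j) ->
  MB_number e dfirst = Some k.
Proof.
move=> can_k min_k; rewrite /MB_number; case: pselect => [ex|[]]; last first.
  by exists k; apply/asboolP.
congr Some; case: ex_minnP => m /asboolP can_m le_m; apply/eqP.
rewrite eqn_leq le_m /=; last by apply/asboolP.
by rewrite leqNgt; apply/negP => /min_k.
Qed.

(** * The pairing strategy for disjoint pairs *)

Section Blocks.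
Variables (T : finType) (dfirst : bool) (K : nat) (B : 'I_K -> {set T}).
Hypothesis card_B : forall i, #|B i| = 2.
Hypothesis B_inj : forall i j x, x \in B i -> x \in B j -> i = j.
Implicit Types (h : seq T).

Definition first_moves h : seq T := take K (Dmoves dfirst h).

Definition unhit h : {set 'I_K} :=
  [set i | [forall x in B i, x \notin first_moves h]].

(* The invariant of Dominator when Staller is to move. *)
Definition paired h : Prop :=
  size (first_moves h) + #|unhit h| <= K /\
  forall i, i \in unhit h -> {in B i, forall x, x \notin h}.

Lemma first_moves_rcons h v :
  {subset first_moves h <= first_moves (rcons h v)}.
Proof.
rewrite /first_moves Dmoves_rcons; case: (Dturn _ _) => //.
rewrite -cats1 take_cat; case: ltnP => _ x xE //.
by rewrite mem_cat (mem_take xE).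
Qed.

Lemma first_moves_Sturn h s :
  ~~ Dturn dfirst (size h) -> first_moves (rcons h s) = first_moves h.
Proof. by rewrite /first_moves Dmoves_rcons => /negbTE ->. Qed.

(** Serves for opening moves and replies alike. Staller may have entered an unhit pair, but only one
    that [d] hits, so the invariant is repaired. *)
Lemma paired_Dmove h d : Dturn dfirst (size h) ->
    size (first_moves h) + #|unhit h| <= K ->
    (forall i, i \in unhit h -> d \notin B i -> {in B i, forall x, x \notin h}) ->
    (exists2 i, i \in unhit h & d \in B i) \/ unhit h = set0 ->
  paired (rcons h d).
Proof.
move=> Dt szE untouched hit.
have subU : unhit (rcons h d) \subset unhit h.
  apply/subsetP=> i; rewrite !inE => /forall_inP iU'; apply/forall_inP => x xB.
  by apply: contra (iU' x xB); apply: first_moves_rcons.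
case: hit => [[i iU dB]|U0]; last first.
  have U0' : unhit (rcons h d) = set0 by apply/eqP; rewrite -subset0 -U0.
  split=> [|i]; last by rewrite U0' inE.
  by rewrite U0' cards0 addn0 size_take; case: ltnP => // /ltnW.
have U_gt0 : 0 < #|unhit h| by apply/card_gt0P; exists i.
(* Some pair is unhit, so fewer than [K] moves were made and [d] counts among the first [K]. *)
have ltK : size (Dmoves dfirst h) < K.
  by move: szE; rewrite size_take; case: (ltnP K); lia.
have E1 : first_moves (rcons h d) = rcons (first_moves h) d.
  rewrite /first_moves Dmoves_rcons Dt !take_oversize ?size_rcons //.
  exact: ltnW.
have iU' : i \notin unhit (rcons h d).
  rewrite inE E1; apply/forall_inPn; exists d => //.
  by rewrite negbK mem_rcons mem_head.
split=> [|j jU'].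
  suff : #|unhit (rcons h d)| < #|unhit h| by rewrite E1 size_rcons; lia.
  apply: proper_card; apply/properP; split=> //; exists i => //.
have jU := subsetP subU _ jU'.
have dBj : d \notin B j.
  by apply: contra iU' => dBj; rewrite (B_inj dB dBj).
move=> x xB; rewrite mem_rcons inE negb_or (untouched j) // andbT.
by apply: contra dBj => /eqP <-.
Qed.

Lemma paired_round h s : uniq (rcons h s) -> size h + 2 <= #|T| ->
    ~~ Dturn dfirst (size h) -> paired h ->
  exists2 d, d \notin rcons h s & paired (rcons (rcons h s) d).
Proof.
move=> Uhs size_h St [szE untouched].
have Dt : Dturn dfirst (size (rcons h s)).
  by rewrite size_rcons /Dturn /= addNb.
have Ehs : unhit (rcons h s) = unhit h.
  by apply/setP=> i; rewrite !inE first_moves_Sturn.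
have [U0|[i0 i0U]] := set_0Vmem (unhit h).
  have [|d dh] := @exists_notin T (rcons h s); first by rewrite size_rcons; lia.
  exists d => //; apply: paired_Dmove; rewrite ?Ehs ?first_moves_Sturn //.
    by move=> i; rewrite U0 inE.
  by right.
(* The pair to answer in: the unhit one that [s] enters if there is one, else any unhit pair. *)
have [i [iU sB]] : exists i, i \in unhit h /\
    forall j, j \in unhit h -> s \in B j -> j = i.
  have [/exists_inP[i iU si]|/exists_inPn noi] :=
    boolP [exists i in unhit h, s \in B i].
    by exists i; split=> // j _ sj; apply: B_inj si.
  by exists i0; split=> // j /noi /negbTE ->.
have [d dB ds] : exists2 d, d \in B i & d != s.
  have : 0 < #|B i :\ s| by move: (cardsD1 s (B i)); rewrite card_B; lia.
  by case/card_gt0P => d; rewrite !inE => /andP[]; exists d.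
have dhs : d \notin rcons h s.
  by rewrite mem_rcons inE (negbTE ds) (untouched i).
exists d => //; apply: paired_Dmove; rewrite ?Ehs ?first_moves_Sturn //.
  move=> j jU dBj x xB; rewrite mem_rcons inE negb_or (untouched j) // andbT.
  by apply: contra dBj => /eqP xs; rewrite (sB j jU) // -xs.
by left; exists i.
Qed.

(** An unhit pair would consist of two free vertices, but at most one is left. *)
Lemma paired_end h i : uniq h -> #|T| <= (size h).+1 -> paired h ->
  exists2 x, x \in B i & x \in first_moves h.
Proof.
move=> Uh size_h [_ untouched].
have [iU|] := boolP (i \in unhit h); last first.
  by rewrite inE => /forall_inPn[x xB]; rewrite negbK; exists x.
have BI : B i :&: [set x in h] = set0.
  apply/setP=> x; rewrite !inE; apply/andP => -[xB].
  by apply/negP; apply: untouched xB.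
have card_h : #|[set x in h]| = size h by rewrite cardsE; apply/card_uniqP.
have := cardsUI (B i) [set x in h]; rewrite BI cards0 card_B card_h.
have := subset_leq_card (subsetT (B i :|: [set x in h])).
by rewrite cardsT; lia.
Qed.

End Blocks.

(** * Rotation and domination on the cycle *)

Section CycleDomination.
Variable n : nat.
Local Notation nxt := (@ordS n).
Local Notation prv := (@ord_pred n).
Implicit Types (v w x c : 'I_n) (D S W : {set 'I_n}).

Lemma val_iter_ordS k c : val (iter k nxt c) = (c + k) %% n.
Proof.
elim: k => [|k IH] /=; first by rewrite addn0 modn_small.
by rewrite IH -[in LHS]addn1 modnDml addn1 addnS.
Qed.

Lemma iter_ordS_inj c i j : i < n -> j < n ->
  iter i nxt c = iter j nxt c -> i = j.
Proof.
move=> lt_i lt_j /(congr1 val); rewrite !val_iter_ordS => /eqP.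
by rewrite eqn_modDl !modn_small // => /eqP.
Qed.

Lemma iter_ordS_neq c k : 0 < k < n -> iter k nxt c != c.
Proof.
case/andP=> k0 kn; apply/eqP => /(@iter_ordS_inj c k 0) k_eq0.
by rewrite k_eq0 // in k0; lia.
Qed.

Lemma iter_ordS_onto c v : exists2 k, k < n & v = iter k nxt c.
Proof.
have n_gt0 : 0 < n by case: n c => [[]|].
exists ((v + n - c) %% n); rewrite ?ltn_mod //.
apply: val_inj; rewrite val_iter_ordS modnDmr.
by rewrite subnKC ?modnDr ?modn_small //; have := ltn_ord c; lia.
Qed.

Definition undom D v := [&& v \notin D, nxt v \notin D & prv v \notin D].

Lemma cycle_dominatingE D : dominating (@cycle_graph n) D = [forall v, ~~ undom D v].
Proof.
apply: eq_forallb => v; apply/exists_inP/idP.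
  case=> u uD; rewrite /cycle_graph /undom; case/or3P=> /eqP vE.
  - by rewrite -vE uD.
  - by rewrite vE ordSK uD !andbF.
  - by rewrite -vE uD !andbF.
rewrite /undom; case: (boolP (v \in D)) => [vD _|_]; first by exists v; rewrite ?eqxx.
case: (boolP (nxt v \in D)) => [vD _|_ /=].
  by exists (nxt v); rewrite // /cycle_graph eqxx !orbT.
rewrite negbK => vD; exists (prv v) => //.
by rewrite /cycle_graph ord_predK eqxx orbT.
Qed.

Lemma undom_setU1 D d v :
  undom (d |: D) v = [&& v != d, nxt v != d, prv v != d & undom D v].
Proof.
rewrite /undom !inE !negb_or.
by case: (v == d); case: (_ == d); case: (_ == d); rewrite ?andbF.
Qed.

Lemma not_dominating D v : undom D v -> ~~ dominating (@cycle_graph n) D.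
Proof.
by move=> Uv; rewrite cycle_dominatingE; apply/forallPn; exists v; rewrite negbK.
Qed.

End CycleDomination.

(** * Threats of Staller on the cycle *)

Section CycleGame.
Variable n : nat.
Local Notation nxt := (@ordS n).
Local Notation prv := (@ord_pred n).
Implicit Types (v w x c : 'I_n) (D S W : {set 'I_n}).

Definition delays := Staller_delays (@cycle_graph n).

(** Dominator can never play in the closed neighbourhood of [z]; Staller just passes by choosing
    [z], which is in [S]. *)
Lemma dead_vertex k D S z :
  undom D z -> [set z; nxt z; prv z] \subset S -> delays k D S.
Proof.
elim: k D S => [|k IH] D S Uz /subsetP sub /=; first exact: not_dominating Uz.
exists z => d /[!inE] /norP[dz dS]; apply: IH.
  rewrite undom_setU1 Uz eq_sym dz /= andbT.
  by apply/andP; split; apply: contra dS => /eqP <-; rewrite sub // !inE eqxx ?orbT.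
by apply/subsetP=> x /sub xS; rewrite inE xS orbT.
Qed.

(** Staller plays [x], the only vertex of the closed neighbourhood of [z] that may be missing from
    [S]. *)
Lemma threat k D S z x :
  undom D z -> [set z; nxt z; prv z] \subset x |: S -> delays k D S.
Proof.
move=> Uz sub; case: k => [|k] /=; first exact: not_dominating Uz.
exists x => d dxS; apply: (dead_vertex _ _ sub).
rewrite undom_setU1 Uz andbT; move/subsetP: sub => sub.
by apply/and3P; split; apply: contra dxS => /eqP <-; rewrite sub // !inE eqxx ?orbT.
Qed.

(* Dominator can parry only one of the threats at [x] and [y]. *)
Lemma double_threat k D S a b x y s : x != y -> undom D a -> undom D b ->
    [set a; nxt a; prv a] \subset x |: (s |: S) ->
    [set b; nxt b; prv b] \subset y |: (s |: S) ->
  delays k D S.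
Proof.
move=> xy Ua Ub suba subb; case: k => [|k] /=; first exact: not_dominating Ua.
have reply z t d : undom D z -> [set z; nxt z; prv z] \subset t |: (s |: S) ->
    d \notin s |: S -> d != t -> delays k (d |: D) (s |: S).
  move=> Uz sub ds dt; apply: (threat _ _ sub).
  have {ds dt}: d \notin t |: (s |: S) by rewrite in_setU1 (negbTE dt).
  rewrite undom_setU1 Uz andbT => ds.
  by apply/and3P; split; apply: contra ds => /eqP <-;
    rewrite (subsetP sub) // !inE eqxx ?orbT.
exists s => d ds; have [dx|] := eqVneq d x; last exact: reply suba _.
by apply: (reply b y) => //; rewrite dx.
Qed.

(** * Delaying by means of an independent set of undominated vertices *)

Definition independent W := forall w, w \in W -> nxt w \notin W.

Lemma independent_prv W w : independent W -> w \in W -> prv w \notin W.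
Proof. by move=> indW wW; apply/negP => /indW; rewrite ord_predK wW. Qed.

Definition undominated_part D W := [set w in W | undom D w].

(** The bounds force [d] to dominate two vertices of [W]. Both lie among [d] and its neighbours, and
    independence leaves only the two neighbours. *)
Lemma Dmove_kills_two W D d k : independent W -> {in W, forall w, undom D w} ->
    k.+1 < #|W| -> #|undominated_part (d |: D) W| <= k ->
  [/\ d \notin W, nxt d \in W & prv d \in W].
Proof.
move=> indW UW ltW leW.
have : 1 < #|W :\: undominated_part (d |: D) W|.
  have := cardsID (undominated_part (d |: D) W) W.
  rewrite (setIidPr _); first lia.
  by apply/subsetP=> w; rewrite inE => /andP[].
have killed w : w \in W :\: undominated_part (d |: D) W ->
    w \in W /\ [|| w == d, w == prv d | w == nxt d].
  rewrite !inE undom_setU1 => /andP[+ wW]; rewrite wW UW // andbT /= !negb_and !negbK.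
  case/or3P=> /eqP <-; rewrite ?ordSK ?ord_predK !eqxx ?orbT //.
case/card_gt1P => x [y [/killed[xW xd] /killed[yW yd] xy]].
have [x0 y0] := (indW x xW, indW y yW).
have [x1 y1] := (independent_prv indW xW, independent_prv indW yW).
move: xy; case/or3P: xd => /eqP xE; case/or3P: yd => /eqP yE;
  move: xW yW x0 y0 x1 y1; rewrite xE yE ?eqxx ?ordSK ?ord_predK //;
  try (by move=> ? ->); by move=> -> -> _ //.
Qed.

(* The double threat needs five vertices, hence the first hypothesis. *)
Lemma delay_of_independent k D S W : 4 < n \/ k <= 1 -> independent W ->
  {in W, forall w, undom D w} -> k < #|W| -> delays k D S.
Proof.
elim: k D S W => [|k IH] D S W n_k indW UW ltW /=.
  by case/card_gt0P: ltW => w /UW; apply: not_dominating.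
have cont d s : k < #|undominated_part (d |: D) W| -> delays k (d |: D) (s |: S).
  apply: IH; first by case: n_k; lia.
    by move=> w; rewrite !inE => /andP[/indW/negbTE-> _].
  by move=> w; rewrite inE => /andP[].
(* Without such a free [v], no reply dominates two vertices of [W], so any move of Staller will
   do. *)
have [/exists_inP[v vS /andP[nvW pvW]]|/exists_inPn nov] :=
    boolP [exists v in ~: S, (nxt v \in W) && (prv v \in W)]; last first.
  have [w _] : exists w, w \in W by apply/card_gt0P/(leq_trans _ ltW).
  exists w => d /[!inE] /norP[_ dS]; apply: cont; rewrite ltnNge.
  apply/negP => /(Dmove_kills_two indW UW ltW)[_ ndW pdW].
  by have := nov d; rewrite inE dS ndW pdW => /(_ isT).
exists v => d /[!inE] /norP[dv dS].
have [|] := ltnP k #|undominated_part (d |: D) W|; first exact: cont.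
case/(Dmove_kills_two indW UW ltW) => dW ndW pdW.
(* The neighbours of [v] are undominated by [D], so [D] misses them and [v]; and [d] is neither [v]
   nor in [W]. *)
have Uv : undom (d |: D) v.
  rewrite undom_setU1 eq_sym dv.
  have [/and3P[nD _ vD] /and3P[pD _ _]] := (UW _ nvW, UW _ pvW).
  rewrite /undom nD pD -[v in v \notin D]ordSK vD !andbT /=.
  by apply/andP; split; apply: contraNneq dW => <-.
have [k0|k_gt0] := posnP k; first by rewrite k0; apply: not_dominating Uv.
have n_gt4 : 4 < n by case: n_k => //; lia.
have far m c : 0 < m < 5 -> iter m nxt c != c.
  by move=> ?; apply: iter_ordS_neq; lia.
(* The second threatened vertex is a neighbour of [v] that [d] does not dominate: [prv v], unless
   [d] is next to it. Staller plays it, and then threatens at both ends of the two vertices he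
   holds. *)
have [d_pp|d_npp] := eqVneq d (prv (prv v)).
  have Un : undom (d |: D) (nxt v).
    rewrite undom_setU1 UW // ordSK [v == d]eq_sym dv !andbT.
    have vE : v = iter 2 nxt d by rewrite d_pp /= !ord_predK.
    (* Here [nxt (nxt v)] is four steps after [d], whence the need for [4 < n]. *)
    by rewrite vE -!iterS !far.
  apply: (@double_threat _ _ _ v (nxt v) (prv v) (nxt (nxt v)) (nxt v)) => //.
  - have -> : nxt (nxt v) = iter 3 nxt (prv v) by rewrite /= ord_predK.
    by rewrite eq_sym far.
  - by apply/subsetP=> x; rewrite !inE => /orP[/orP[]|] ->; rewrite ?orbT.
  - by apply/subsetP=> x; rewrite ordSK !inE => /orP[/orP[]|] ->; rewrite ?orbT.
have Up : undom (d |: D) (prv v).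
  rewrite undom_setU1 UW // ord_predK andbT; apply/and3P.
  by split; [apply: contraNneq dW => <- | rewrite eq_sym | rewrite eq_sym].
apply: (@double_threat _ _ _ v (prv v) (nxt v) (prv (prv v)) (prv v)) => //.
- have -> : nxt v = iter 3 nxt (prv (prv v)) by rewrite /= !ord_predK.
  by rewrite far.
- by apply/subsetP=> x; rewrite !inE => /orP[/orP[]|] ->; rewrite ?orbT.
- by apply/subsetP=> x; rewrite ord_predK !inE => /orP[/orP[]|] ->; rewrite ?orbT.
Qed.

(** * The lower bound *)

Definition alternate c := [set iter i.*2 nxt c | i : 'I_(n %/ 2)].

Lemma card_alternate c : #|alternate c| = n %/ 2.
Proof.
rewrite card_imset ?card_ord // => i j; have := (ltn_ord i, ltn_ord j) => -[li lj].
by move/iter_ordS_inj => ij; apply: val_inj; apply: double_inj; apply: ij; lia.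
Qed.

(** All offsets [i.*2.+1] stay below [n], so nothing wraps around and parity decides. *)
Lemma alternate_independent c : independent (alternate c).
Proof.
move=> _ /imsetP[i _ ->]; apply/imsetP => -[j _].
have := (ltn_ord i, ltn_ord j) => -[li lj].
by rewrite -iterS => /iter_ordS_inj ij; have : i.*2.+1 = j.*2 by [apply: ij; lia]; lia.
Qed.

Lemma MB_lower_bound dfirst k : 2 < n -> k < n %/ 2 ->
  ~ Dominator_can (@cycle_graph n) dfirst k.
Proof.
move=> n_gt2 lt_k [sigma [legal win]].
(* If [n] is 3 or 4, then [n %/ 2 <= 2]. *)
have n_k : 4 < n \/ k <= 1 by lia.
have [c0 _] : exists c : 'I_n, c \notin [::]
    by apply: exists_notin; rewrite card_ord /=; lia.
have U0 v : undom set0 v by rewrite /undom !inE.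
have Dm0 : [set v in Dmoves dfirst ([::] : seq 'I_n)] = set0.
  by apply/setP=> v; rewrite !inE.
suff [p [Up szp fol]] : exists p, [/\ uniq p, size p = #|{: 'I_n}|,
      follows dfirst sigma p
    & ~~ dominating (@cycle_graph n) [set v in take k (Dmoves dfirst p)]].
  by rewrite win.
case: dfirst win Dm0 => [_ Dm0|_ Dm0]; last first.
  have [||||||p] := @delay_play _ false (@cycle_graph n) sigma k [::] set0 legal => //.
  - exact: follows_nil.
  - by rewrite card_ord /=; lia.
  - by move=> x; rewrite inE.
  - rewrite Dm0; apply: (@delay_of_independent _ _ _ (alternate c0)) => //.
      exact: alternate_independent.
    by rewrite card_alternate.
  by exists p.
(* In the D-game the opening move uses up one of the moves of Dominator. *)
case: k lt_k n_k => [|k] lt_k n_k.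
  have [||t [Up szp fol]] := @play_extension _ true sigma [::] legal => //.
    exact: follows_nil.
  exists t; split=> //; rewrite take0; apply: (@not_dominating _ _ c0).
  by rewrite /undom !inE.
set d := sigma [::].
have Dm1 : [set v in Dmoves true [:: d]] = d |: set0.
  by apply/setP=> v; rewrite !inE orbF.
have [||||||p] := @delay_play _ true (@cycle_graph n) sigma k [:: d] set0 legal => //.
- by apply/(follows_rcons _ _ [::]); split=> //; apply: follows_nil.
- by rewrite card_ord /=; lia.
- by move=> x; rewrite inE.
(* The alternating set starts at the opening move [d]: as [d] belongs to it, [d] cannot dominate two
   of its vertices. *)
- have indW := @alternate_independent d; have cardW := card_alternate d.
  rewrite Dm1.
  apply: (@delay_of_independent _ _ _ (undominated_part (d |: set0) (alternate d))).
  + by case: n_k; lia.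
  + by move=> w; rewrite !inE => /andP[/indW/negbTE-> _].
  + by move=> w; rewrite inE => /andP[].
  rewrite ltnNge; apply/negP => leW.
  have [] := @Dmove_kills_two (alternate d) set0 d k => //.
    by rewrite cardW.
  case/imsetP; exists (Ordinal (leq_ltn_trans (leq0n _) lt_k)) => //.
by exists p.
Qed.

(** * The upper bound *)

Definition offset i := if i is 0 then 0 else i.*2 + odd n.

(** For odd [n] the blocks leave out exactly the vertex at offset 2, which is adjacent to
    [nxt c]. *)
Definition block c (i : 'I_(n %/ 2)) :=
  [set iter (offset i) nxt c; iter (offset i).+1 nxt c].

Lemma offset_lt (i : 'I_(n %/ 2)) : (offset i).+1 < n.
Proof. by rewrite /offset; have := ltn_ord i; case: (val i) => [|j]; lia. Qed.

Lemma card_block c i : #|block c i| = 2.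
Proof.
rewrite cards2 eq_sym (@iter_ordS_neq _ _ 1) //.
by have := offset_lt i; lia.
Qed.

Lemma block_inj c i j x : x \in block c i -> x \in block c j -> i = j.
Proof.
have := (offset_lt i, offset_lt j) => -[li lj].
suff off a b : a < 2 -> b < 2 ->
    iter (offset i + a) nxt c = iter (offset j + b) nxt c -> i = j.
  rewrite !inE => /orP[]/eqP->/orP[]/eqP.
  - by move=> E; apply: (off 0 0) => //; rewrite !addn0.
  - by move=> E; apply: (off 0 1) => //; rewrite addn0 addn1.
  - by move=> E; apply: (off 1 0) => //; rewrite addn0 addn1.
  - by move=> E; apply: (off 1 1) => //; rewrite !addn1.
move=> a2 b2 /iter_ordS_inj E; apply: val_inj => /=.
have {E} : offset i + a = offset j + b by apply: E; lia.
by rewrite /offset; case: (val i) (val j) => [|i'] [|j']; lia.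
Qed.

Lemma block_dominates c D : 2 < n -> nxt c \in D ->
    (forall i, exists2 x, x \in block c i & x \in D) ->
  dominating (@cycle_graph n) D.
Proof.
move=> n_gt2 ncD hit; rewrite cycle_dominatingE; apply/forallP => v.
have [j ltj ->] := iter_ordS_onto c v.
have neighbour a : a \in D ->
    [|| a == iter j nxt c, a == nxt (iter j nxt c) | a == prv (iter j nxt c)] ->
    ~~ undom D (iter j nxt c).
  by rewrite /undom => aD /or3P[]/eqP <-; rewrite aD ?andbF.
have in_block (i : 'I_(n %/ 2)) : offset i <= j <= (offset i).+1 ->
    ~~ undom D (iter j nxt c).
  move=> ij; have [x xB xD] := hit i; apply: (neighbour x) => //.
  move: xB; rewrite !inE; have [-> |->] : j = offset i \/ j = (offset i).+1 by lia.
    by case/orP=> ->; rewrite ?orbT.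
  by rewrite /= ordSK; case/orP=> ->; rewrite ?orbT.
(* Beyond block 0 and the vertex left out, [j] lies in block [(j - odd n) %/ 2]. *)
have [j2|j2] := leqP j (1 + odd n); last first.
  have lti : (j - odd n) %/ 2 < n %/ 2 by lia.
  apply: (in_block (Ordinal lti)); rewrite /offset /=.
  by case E: (_ %/ 2) => [|m]; lia.
have [jE|jE] := eqVneq j 2.
  by apply: (neighbour _ ncD); rewrite jE /= ordSK eqxx !orbT.
have lt0 : 0 < n %/ 2 by lia.
by apply: (in_block (Ordinal lt0)); rewrite /offset /=; lia.
Qed.

Lemma MB_upper_bound dfirst : 2 < n ->
  Dominator_can (@cycle_graph n) dfirst (n %/ 2).
Proof.
move=> n_gt2; have K_gt0 : 0 < n %/ 2 by lia.
pose K := n %/ 2; pose i0 : 'I_K := Ordinal K_gt0.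
pose Good h c := nxt c \in first_moves dfirst K h /\ paired dfirst (block c) h.
have unhit_le h (B : 'I_K -> {set 'I_n}) : #|unhit dfirst B h| <= K.
  by rewrite -[leqRHS]card_ord max_card.
(* Covers the first move of Dominator in both games: [h] is empty in the D-game and [[:: c]] in the
   S-game. Block 0, the only one containing [c], is hit at once. *)
have start h c : size h <= 1 -> {subset h <= [:: c]} -> Dturn dfirst (size h) ->
    first_moves dfirst K h = [::] -> Good (rcons h (nxt c)) c.
  move=> szh hc Dt fm; split.
    move: fm; rewrite /first_moves Dmoves_rcons Dt /K -(prednK K_gt0).
    by case: (Dmoves _ _) => //= _; rewrite mem_head.
  apply: paired_Dmove => //.
  - exact: block_inj.
  - by rewrite fm /= unhit_le.
  - move=> i _ ncB x xB; apply: contra ncB => /hc; rewrite inE => /eqP xc.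
    have c0 : c \in block c i0 by rewrite !inE eqxx.
    have -> : i = i0 by apply: (block_inj xB); rewrite xc.
    by rewrite !inE eqxx orbT.
  - left; exists i0; last by rewrite !inE eqxx orbT.
    by rewrite inE fm; apply/forall_inP.
(* The first alternative is the start of the S-game, when [c] is not yet chosen. *)
pose Inv h := (h = [::] /\ ~~ dfirst) \/ exists c, Good h c.
apply: (strategy_of_invariant (Inv := Inv)); last by rewrite card_ord; lia.
- case df: dfirst; last by left; rewrite df.
  have [c _] : exists c : 'I_n, c \notin [::]
    by apply: exists_notin; rewrite card_ord /=; lia.
  exists (nxt c); right; exists c; apply: (start [::]) => //.
- move=> h s Uhs szh St [[h0 df]|[c [ncE ph]]].
    (* The blocks are laid out from the first vertex [s] of Staller, so that [c] is [s]. *)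
    rewrite h0 /=; exists (nxt s).
      rewrite inE; apply: (@iter_ordS_neq _ s 1); lia.
    right; exists s; apply: (start [:: s]) => //.
    by case: (dfirst) df.
  have [d dhs pd] := paired_round (card_block c) (@block_inj c) Uhs szh St ph.
  exists d => //; right; exists c; split=> //.
  by do 2 apply: first_moves_rcons.
move=> h Uh szh St [[h0 _]|[c [ncE ph]]]; first by rewrite h0 card_ord /= in szh; lia.
apply: (@block_dominates c) => //; first by rewrite inE.
move=> i; have [x xB xE] := paired_end (card_block c) i Uh szh ph.
by exists x; rewrite // inE.
Qed.

End CycleGame.

Theorem theorem5p1 (n : nat) (hn : 3 <= n) :
  gammaMB (@cycle_graph n) = Some (n %/ 2) /\
  gammaMB' (@cycle_graph n) = Some (n %/ 2).
Proof.
by split; (apply: MB_numberP => [|k]; first exact: MB_upper_bound);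
  apply: MB_lower_bound.
Qed.
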